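(* Let $A$ be an $n\times n$ nilpotent matrix over an entire antiring $S$. Then $A$ can be written as $$A=\sum_{i=1}^{\lceil \log_2 n\rceil} B_i ,$$ where each $B_i\in M_n(S)$ is a square-zero matrix (i.e. $B_i^2=0$). Moreover, for every $n$ there exists a nilpotent matrix $A\in M_n(S)$ such that it cannot be written as a sum of $k$ square-zero matrices, where $k<\log_2 n$.
   Context: Here $n$ is a positive integer and $M_n(S)$ is the set of $n\times n$ matrices over $S$. A semiring is a set $S$ with operations $+$ and $\cdot$ such that $(S,+)$ is a commutative monoid with identity $0$, $(S,\cdot)$ is a monoid with identity $1$, multiplication distributes over addition, and $0$ annihilates $S$. An antiring is a semiring that is zerosumfree: $a+b=0$ implies $a=b=0$ for all $a,b\in S$. An antiring is entire if $ab=0$ implies $a=0$ or $b=0$. A matrix $A\in M_n(S)$ is nilpotent if $A^m=0$ for some positive integer $m$. An empty sum of matrices is the zero matrix.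
   Formalization: The ''moreover'' part is stated for semirings with 1 ≠ 0; over the one-element semiring it fails for n ≥ 2, since the only matrix is 0, which is the empty sum (k = 0). *)

(* Defs.v *)
From mathcomp Require Import all_boot all_order all_algebra.

Set Implicit Arguments.
Unset Strict Implicit.
Unset Printing Implicit Defensive.

Import GRing.Theory.
Local Open Scope ring_scope.

(* The trivial semiring (0 = 1) is allowed, and multiplication need not be
   commutative: this is exactly pzSemiRingType. *)
Definition antiring (S : pzSemiRingType) : Prop :=
  forall a b : S, a + b = 0 -> a = 0 /\ b = 0.

Definition entire (S : pzSemiRingType) : Prop :=
  forall a b : S, a * b = 0 -> a = 0 \/ b = 0.

Definition nilpotent_mx (S : pzSemiRingType) (n : nat) (A : 'M[S]_n) : Prop :=
  exists m : nat, (0 < m)%N /\ A ^+ m = 0.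

Definition square_zero_mx (S : pzSemiRingType) (n : nat) (B : 'M[S]_n) : Prop :=
  B ^+ 2 = 0.

Definition sum_of_square_zero (S : pzSemiRingType) (n k : nat) (A : 'M[S]_n) :
    Prop :=
  exists B : 'I_k -> 'M[S]_n,
    (forall i : 'I_k, square_zero_mx (B i)) /\ A = \sum_(i < k) B i.

(* Main.v *)
Require Import Defs.
From mathcomp Require Import all_boot all_order all_algebra.

Set Implicit Arguments.
Unset Strict Implicit.
Unset Printing Implicit Defensive.

Import GRing.Theory.
Local Open Scope ring_scope.

(** Over an entire antiring the support of a matrix is a digraph, and supports
    multiply like relations.  Nilpotency makes the digraph acyclic, so counting
    the proper descendants of a vertex gives a height [h i < n <= 2 ^ k] that
    decreases along edges.  An edge [i -> j] is put in the class of the highest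
    binary digit where [h i] and [h j] differ; this digit is 1 at [i] and 0 at
    [j], so no two edges of the same class are consecutive.

    Conversely, let the strictly upper triangular all-ones matrix be a sum of
    square-zero matrices [B t], [t < k].  For [i < j] some [t] has
    [B t i j != 0]; then row [i] of [B t] is nonzero and row [j] of [B t] is
    zero.  So the sets [{t | row i of B t is nonzero}] are pairwise distinct,
    and [n <= 2 ^ k]. *)

(** Induction on [k], peeling off the last binary digit: edges whose ends have equal halved heights
    form one square-zero summand, and the others still descend in the halved heights, which lie
    below [2 ^ k]. *)
Lemma sum_square_zero_of_height (S : pzSemiRingType) (n k : nat)
    (A : 'M[S]_n) (h : 'I_n -> nat) :
  (forall i, h i < 2 ^ k)%N ->
  (forall i j, A i j != 0 -> (h j < h i)%N) ->
  sum_of_square_zero k A.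
Proof.
elim: k A h => [|k IHk] A h h_lt hA.
  exists (fun=> 0); split=> [[]//|]; rewrite big_ord0.
  apply/matrixP=> i j; rewrite mxE; apply/eqP; apply: contraT => /hA.
  by move: (h_lt i); rewrite ltnS leqn0 => /eqP->.
(* [B0] collects the edges whose ends differ only in the last binary digit. *)
pose B0 : 'M[S]_n := \matrix_(i, j) (if (h i)./2 == (h j)./2 then A i j else 0).
pose A' : 'M[S]_n := \matrix_(i, j) (if (h i)./2 == (h j)./2 then 0 else A i j).
have B0_odd i j : B0 i j != 0 -> odd (h i) && ~~ odd (h j).
  rewrite mxE; have [eq_half /hA|_] := (h i)./2 =P (h j)./2; last by rewrite eqxx.
  rewrite -[h i]odd_double_half -[h j]odd_double_half eq_half ltn_add2r.
  by rewrite !oddD !odd_double; do 2!case: (odd _).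
have [i||B [B_sqr A'E]] := IHk A' (fun i => (h i)./2).
- by rewrite ltn_half_double -mul2n -expnS.
- move=> i j; rewrite mxE; have [_|neq_half /hA h_ji] := eqVneq (h i)./2 (h j)./2.
    by rewrite eqxx.
  by rewrite ltn_neqAle eq_sym neq_half half_leq // ltnW.
exists (fun t => if unlift ord0 t is Some u then B u else B0); split.
  move=> t; case: unliftP => [u _|_]; first exact: B_sqr.
  rewrite /square_zero_mx expr2; apply/matrixP=> i j.
  rewrite !mxE big1 // => l _.
  have [->|/B0_odd/andP[_ even_l]] := eqVneq (B0 i l) 0; first by rewrite mul0r.
  have [->|/B0_odd/andP[odd_l _]] := eqVneq (B0 l j) 0; first by rewrite mulr0.
  by rewrite odd_l in even_l.
rewrite big_ord_recl unlift_none.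
under eq_bigr => u _ do rewrite liftK.
rewrite -A'E; apply/matrixP=> i j; rewrite !mxE.
by case: eqP => _; rewrite ?addr0 ?add0r.
Qed.

Section EntireAntiring.

Variables (S : pzSemiRingType) (antiS : antiring S) (entS : entire S).

Lemma antiring_sum_eq0 (I : finType) (F : I -> S) :
  \sum_i F i = 0 -> forall i, F i = 0.
Proof. by move=> sum0 i; move: sum0; rewrite (bigD1 i) //= => /antiS[]. Qed.

Lemma mulmx_neq0 (n : nat) (A B : 'M[S]_n) i l j :
  A i l != 0 -> B l j != 0 -> (A * B) i j != 0.
Proof.
move=> Ail Blj; apply/eqP; rewrite mxE => /antiring_sum_eq0/(_ l)/entS[] /eqP.
  exact/negP.
exact/negP.
Qed.

Lemma expmx_diag_neq0 (n : nat) (A : 'M[S]_n) i m :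
  1 != 0 :> S -> A i i != 0 -> (A ^+ m) i i != 0.
Proof.
move=> one_neq0 Aii; elim: m => [|m IHm]; first by rewrite expr0 mxE eqxx.
by rewrite exprS; apply: mulmx_neq0 IHm.
Qed.

Lemma nilpotent_height (n : nat) (A : 'M[S]_n) :
  1 != 0 :> S -> nilpotent_mx A ->
  exists h : 'I_n -> nat,
    (forall i, h i < n)%N /\ (forall i j, A i j != 0 -> (h j < h i)%N).
Proof.
move=> one_neq0 [N [N_gt0 AN0]].
(* Vertices reached by walks of length 1 to [N]; longer walks vanish since [A ^+ N = 0], so the
   bound loses nothing and keeps the condition boolean. *)
pose D i := [set j | [exists m : 'I_N, (A ^+ m.+1) i j != 0]].
have DP i j m : (A ^+ m.+1) i j != 0 -> j \in D i.
  move=> Am; rewrite inE; apply/existsP.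
  have [ltmN|leNm] := ltnP m N; first by exists (Ordinal ltmN).
  by move: Am; rewrite -(subnK (leqW leNm)) exprD AN0 mulr0 mxE eqxx.
have D_irr i : i \notin D i.
  (* Repeating a closed walk at [i] of length [m.+1] [N] times gives a nonzero diagonal entry of
     [(A ^+ N) ^+ m.+1 = 0]. *)
  rewrite inE; apply/existsP=> -[m /(expmx_diag_neq0 N one_neq0)].
  by rewrite -exprM mulnC exprM AN0 expr0n /= mxE eqxx.
exists (fun i => #|D i|); split=> [i|i j Aij].
  have: D i \proper [set: 'I_n] by apply/properP; split; [|exists i].
  by move/proper_card; rewrite cardsT card_ord.
apply/proper_card/properP; split; last by exists j; rewrite ?(DP i j 0%N).
apply/subsetP=> l; rewrite inE => /existsP[m Ajl].
by apply: (DP i l m.+1); rewrite exprS; apply: mulmx_neq0 Ajl.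
Qed.

Lemma leq_exp_sum_square_zero (n k : nat) (A : 'M[S]_n) :
  (forall i j : 'I_n, (i < j)%N -> A i j != 0) ->
  sum_of_square_zero k A -> (n <= 2 ^ k)%N.
Proof.
move=> A_neq0 [B [B_sqr AE]].
pose sigma i := [set t | [exists j, B t i j != 0]].
have sigma_neq (i j : 'I_n) : (i < j)%N -> sigma i != sigma j.
  move=> /A_neq0; rewrite AE summxE => sum_neq0.
  have [t Bij] : exists t, B t i j != 0.
    apply/existsP; apply: contraR sum_neq0; rewrite negb_exists => /forallP B0.
    by rewrite big1 // => t _; apply/eqP/negPn/B0.
  apply/eqP=> /setP/(_ t); rewrite !inE.
  have -> : [exists l, B t i l != 0] by apply/existsP; exists j.
  move/esym/existsP=> [l Bjl].
  by have := mulmx_neq0 Bij Bjl; rewrite -expr2 B_sqr mxE eqxx.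
have sigma_inj : injective sigma.
  move=> i j /eqP; case: (ltngtP i j) => [/sigma_neq/negPf->//||/val_inj//].
  by rewrite eq_sym => /sigma_neq/negPf->.
have := leq_card sigma sigma_inj.
by rewrite -[#|{: {set _}}|]cardsT -powersetT card_powerset cardsT !card_ord.
Qed.

End EntireAntiring.

(** Each edge raises the index by at least one, so a walk of length [n] would leave ['I_n]. *)
Lemma strictly_upper_nilpotent (S : pzSemiRingType) (n : nat) (A : 'M[S]_n) :
  (0 < n)%N -> (forall i j : 'I_n, A i j != 0 -> (i < j)%N) -> nilpotent_mx A.
Proof.
move=> n_gt0 A_upper; exists n; split=> //.
have Am m (i j : 'I_n) : (A ^+ m) i j != 0 -> (i + m <= j)%N.
  elim: m i => [|m IHm] i.
    by rewrite expr0 mxE addn0; case: (i =P j) => [->|_]; rewrite ?eqxx.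
  apply: contraNT; rewrite exprS mxE -ltnNge addnS ltnS => lt_j.
  rewrite big1 // => l _.
  have [->|/A_upper lt_il] := eqVneq (A i l) 0; first by rewrite mul0r.
  have [->|/IHm le_j] := eqVneq ((A ^+ m) l j) 0; first by rewrite mulr0.
  have: (i + m < i + m)%N.
    by apply: leq_trans lt_j; apply: leq_trans le_j; rewrite -addSn leq_add2r.
  by rewrite ltnn.
apply/matrixP=> i j; rewrite [RHS]mxE; apply/eqP; apply: contraT => /Am.
by rewrite leqNgt (leq_trans (ltn_ord j)) ?leq_addl.
Qed.

(* MathComp world. [up_log 2 n] is the ceiling of log_2 n (least e with
   n <= 2 ^ e), and, for natural k, k < log_2 n reads 2 ^ k < n. *)
Theorem theorem11 (S : pzSemiRingType) (antiS : antiring S)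
    (entS : entire S) (n : nat) (n_gt0 : (0 < n)%N) :
  (forall A : 'M[S]_n, nilpotent_mx A -> sum_of_square_zero (up_log 2 n) A)
  /\
  (1 != 0 :> S ->
   exists A : 'M[S]_n,
     nilpotent_mx A /\
     forall k : nat, (2 ^ k < n)%N -> ~ sum_of_square_zero k A).
Proof.
split=> [A nilA|one_neq0].
  (* In the trivial semiring nonzero entries cannot detect edges, but every matrix is zero. *)
  have [one0|one_neq0] := eqVneq (1 : S) 0.
    have S0 (x : S) : x = 0 by rewrite -[x]mul1r one0 mul0r.
    exists (fun=> 0); split=> [t|]; first by rewrite /square_zero_mx expr0n.
    by apply/matrixP=> i j; rewrite [LHS]S0 [RHS]S0.
  have [h [h_lt hA]] := nilpotent_height antiS entS one_neq0 nilA.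
  apply: (sum_square_zero_of_height (h := h)) => // i.
  by apply: leq_trans (h_lt i) _; apply: up_logP.
pose A : 'M[S]_n := \matrix_(i, j) (if (i < j)%N then 1 else 0).
exists A; split=> [|k lt_kn].
  apply: strictly_upper_nilpotent => // i j.
  by rewrite mxE; case: ifP; rewrite ?eqxx.
move=> /(leq_exp_sum_square_zero antiS entS) le_nk.
have: (n <= 2 ^ k)%N by apply: le_nk => i j lt_ij; rewrite mxE lt_ij.
by rewrite leqNgt lt_kn.
Qed.
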